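(* For each integer $i\geq1$, $\mathrm{Aut}_i(H)$ is a normal subgroup of $\mathrm{Aut}_*(H)$, and for $1\le i\le j$ let $\pi_i^j:\mathrm{Aut}_*(H)/\mathrm{Aut}_j(H)\to\mathrm{Aut}_*(H)/\mathrm{Aut}_i(H)$ be the canonical epimorphism. Then $\{\mathrm{Aut}_*(H)/\mathrm{Aut}_i(H),\pi_i^j\}$ is an inverse system of groups indexed by the positive integers, and the map $\mathrm{Aut}_*(H)\to\varprojlim\mathrm{Aut}_*(H)/\mathrm{Aut}_i(H)$, $\phi\mapsto(\phi\,\mathrm{Aut}_i(H))_{i\geq1}$, is a group isomorphism.
   Context: Let $k$ be a field and $0\neq q\in k$ not a root of unity. Let $H=k_q[x,x^{-1},y]$ be the $k$-algebra generated by $x,x^{-1},y$ subject to $xx^{-1}=x^{-1}x=1$, $yx=qxy$, a Hopf algebra with $\Delta(x)=x\otimes x$, $\Delta(x^{-1})=x^{-1}\otimes x^{-1}$, $\Delta(y)=y\otimes x+1\otimes y$, $\varepsilon(x)=1$, $\varepsilon(y)=0$. The elements $x^ny^m$ ($n\in\mathbb{Z}$, $m\in\mathbb{N}$) form a $k$-basis, and $\Delta(x^ny^m)=\sum_{i=0}^m\binom{m}{i}_q x^ny^i\otimes x^{n+i}y^{m-i}$ ($q$-binomial coefficients). Let $H_0=\mathrm{span}\{x^n:n\in\mathbb{Z}\}$ and $H(m)=H_0y^m$. $\mathrm{Aut}_c(H)$ is the group under composition of coalgebra automorphisms of $H$; $\mathrm{Aut}_0(H)=\{\phi\in\mathrm{Aut}_c(H):\phi(1)=1\}$;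 $\mathrm{Aut}_*(H)$ is the set of $\phi\in\mathrm{Aut}_0(H)$ such that for each $n\in\mathbb{Z}$ there is $\beta_n\in k$ with $\phi(x^ny)=x^ny+\beta_n(x^{n+1}-x^n)$; for $m\geq1$, $\mathrm{Aut}_m(H)=\{\phi\in\mathrm{Aut}_c(H):\phi(h)=h\ \text{for all }h\in\sum_{i=0}^mH(i)\}$. *)

(* Defs.v *)
(* with multinomials' monoid algebras {malg k[K]} used as
   free k-vector spaces with a given basis K. *)
From HB Require Import structures.
From mathcomp Require Import all_boot all_order all_algebra.
From mathcomp Require Import finmap.
From mathcomp.multinomials Require Import monalg.
Set Implicit Arguments. Unset Strict Implicit. Unset Printing Implicit Defensive.
Import Order.TTheory GRing.Theory Num.Theory.
Local Open Scope ring_scope.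

(* Basis index of H:  (n, m)  stands for  x^n y^m,  n : int, m : nat. *)
Definition KB : Type := (int * nat)%type.

Section QuantumPlane.
Variables (k : fieldType) (q : k).

(* H as a k-vector space with basis {x^n y^m}, and H (x) H with basis
   {x^a y^i (x) x^c y^j}. *)
Definition Hv := {malg k[KB]}.
Definition Tv := {malg k[(KB * KB)%type]}.

Definition qint (n : nat) : k := \sum_(l < n) q ^+ l.
Definition qfact (n : nat) : k := \prod_(l < n) qint l.+1.
Definition qbinom (m i : nat) : k := qfact m / (qfact i * qfact (m - i)).

Definition tens (u v : Hv) : Tv :=
  \sum_(a <- msupp u) \sum_(c <- msupp v) << u@_a * v@_c *g (a, c) >>.

Definition comul_basis (b : KB) : Tv :=
  \sum_(i < b.2.+1)
     qbinom b.2 i *: << ((b.1, (i : nat)), (b.1 + (i : nat)%:Z, (b.2 - i)%N)) >>.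

Definition comul (h : Hv) : Tv := \sum_(b <- msupp h) h@_b *: comul_basis b.

Definition counit (h : Hv) : k :=
  \sum_(b <- msupp h) (if b.2 == 0%N then h@_b else 0).

(* phi (x) phi applied to an element of H (x) H (phi assumed linear) *)
Definition tensmap (f : Hv -> Hv) (w : Tv) : Tv :=
  \sum_(p <- msupp w) w@_p *: tens (f << p.1 >>) (f << p.2 >>).

Definition is_klinear (f : Hv -> Hv) : Prop :=
  forall (a : k) (u v : Hv), f (a *: u + v) = a *: f u + f v.

Definition mon (n : int) (m : nat) : Hv := << (n, m) >>.

Definition Aut_c (f : Hv -> Hv) : Prop :=
  [/\ is_klinear f, bijective f,
      (forall h, comul (f h) = tensmap f (comul h)) &
      (forall h, counit (f h) = counit h)].

Definition Aut_0 (f : Hv -> Hv) : Prop := Aut_c f /\ f (mon 0 0) = mon 0 0.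

Definition Aut_star (f : Hv -> Hv) : Prop :=
  Aut_0 f /\
  forall n : int, exists beta : k,
    f (mon n 1) = mon n 1 + beta *: (mon (n + 1) 0 - mon n 0).

Definition Aut_m (m : nat) (f : Hv -> Hv) : Prop :=
  Aut_c f /\
  forall h : Hv, (forall b, b \in msupp h -> (b.2 <= m)%N) -> f h = h.

End QuantumPlane.

Section MapGroups.
Variable T : Type.
Definition mset := (T -> T) -> Prop.

Definition is_group (G : mset) : Prop :=
  [/\ G id,
      (forall f g, G f -> G g -> G (f \o g)) &
      (forall f g, G f -> cancel f g -> cancel g f -> G g)].

Definition is_normal_subgroup (G N : mset) : Prop :=
  [/\ is_group N, (forall f, N f -> G f) &
      (forall f finv g, G f -> cancel f finv -> cancel finv f -> N g ->
                        N (f \o g \o finv))].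

Definition lcoset (N : mset) (f : T -> T) : mset :=
  fun g => exists h, N h /\ g = f \o h.

Definition in_quot (G N : mset) (C : mset) : Prop :=
  exists f, G f /\ C = lcoset N f.

Definition setmul (C D : mset) : mset :=
  fun g => exists f h, [/\ C f, D h & g = f \o h].

(* canonical map  G/M -> G/N :  fM |-> fN *)
Definition qproj (N : mset) (C : mset) : mset :=
  fun g => exists f, C f /\ lcoset N f g.
End MapGroups.

(* Main.v *)
(* The one nontrivial point is that every f in Aut_*(H) preserves the filtration
   F_m = sum_(i <= m) H(i).  In Delta h the coefficient of
   x^a y^i (x) x^(a+i) y^j is the q-binomial (i+j choose i)_q, which is nonzero
   as q is not a root of unity, times the coefficient of x^a y^(i+j) in h.
   Since f fixes the group-likes x^n, induction on m shows
   Delta (f (x^n y^m)) in F_(m-1) (x) H + H (x) F_0, and a basis element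
   x^a y^M with M > m in f (x^n y^m) would contribute x^a y^(M-1) (x) x^(a+M-1) y.
   Hence f and its inverse restrict to each F_m; this gives normality of Aut_m(H),
   and a compatible family of cosets f_i Aut_i(H) consists of maps that agree on
   the F_i, so they glue to one automorphism. *)
Require Import Defs.
From Stdlib Require Import FunctionalExtensionality PropExtensionality.
From Stdlib Require Import IndefiniteDescription.
From HB Require Import structures.
From mathcomp Require Import all_boot all_order all_algebra.
From mathcomp Require Import finmap.
From mathcomp.multinomials Require Import monalg.
Import Order.TTheory GRing.Theory Num.Theory.
Local Open Scope ring_scope.

Set Implicit Arguments. Unset Strict Implicit. Unset Printing Implicit Defensive.

(** * Cosets and their products for groups of self-maps *)

Section Quotients.
Variable T : Type.
Implicit Types (G N M C D : mset T) (f g h : T -> T).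

Lemma mset_ext C D : (forall f, C f <-> D f) -> C = D.
Proof.
by move=> e; apply: functional_extensionality => f; apply: propositional_extensionality.
Qed.

(** [is_group] is closed under inverses that are already given; this supplies their existence. *)
Definition has_inverses G :=
  forall f, G f -> exists2 g, G g & cancel f g /\ cancel g f.

Lemma lcoset_id N f : is_group N -> lcoset N f f.
Proof. by case=> Nid _ _; exists id. Qed.

Lemma lcoset_mulr N f h :
  is_group N -> has_inverses N -> N h -> lcoset N (f \o h) = lcoset N f.
Proof.
case=> _ Nmul _ Ninv Nh; apply: mset_ext => x; split=> -[h' [Nh' ->]].
  by exists (h \o h'); split=> //; apply: Nmul.
have [g Ng [hg gh]] := Ninv _ Nh; exists (g \o h'); split; first exact: Nmul.
by apply: functional_extensionality => t /=; rewrite gh.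
Qed.

Lemma qproj_lcoset N M f :
    is_group N -> is_group M -> (forall h, M h -> N h) ->
  qproj N (lcoset M f) = lcoset N f.
Proof.
move=> [Nid Nmul _] grM sMN; apply: mset_ext => x; split.
  by case=> _ [[h [Mh ->]] [h' [Nh' ->]]]; exists (h \o h'); split=> //; apply: Nmul; auto.
by move=> fNx; exists f; split=> //; apply: lcoset_id.
Qed.

Lemma setmul_lcoset G N f g :
    has_inverses G -> is_normal_subgroup G N -> G g ->
  setmul (lcoset N f) (lcoset N g) = lcoset N (f \o g).
Proof.
move=> Ginv [[Nid Nmul _] _ nN] Gg; apply: mset_ext => x; split.
  case=> _ [_ [[h [Nh ->]] [h' [Nh' ->]] ->]].
  have [g' Gg' [gg' g'g]] := Ginv _ Gg.
  (* Here f h g h' = f g (g' h g) h', and normality is applied to conjugation by [g'], the inverse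
     of [g]. *)
  exists ((g' \o h \o g) \o h'); split; first by apply: Nmul => //; apply: nN.
  by apply: functional_extensionality => t /=; rewrite g'g.
case=> h [Nh ->]; exists f, (g \o h).
by split; [exists id | exists h |].
Qed.

End Quotients.

(** * Linear maps on free vector spaces *)

Lemma linear_comb (k : fieldType) (U V : lmodType k) (f : U -> V)
    (I : Type) (r : seq I) (a : I -> k) (u : I -> U) :
  linear f -> f (\sum_(i <- r) a i *: u i) = \sum_(i <- r) a i *: f (u i).
Proof.
move=> lf; pose F := GRing.isLinear.Build k U V *:%R f lf.
pose f' : {linear U -> V} := HB.pack f F.
by rewrite -[f]/(f' : U -> V) linear_sum; apply: eq_bigr => i _; rewrite linearZ.
Qed.

Section LinearExtension.
Variables (k : fieldType) (K : choiceType).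
Implicit Types (V : lmodType k) (u v : {malg k[K]}).

(** Testing only on the support of [u] allows maps to be compared on a single filtration step. *)
Lemma malg_basis_eq V (f g : {malg k[K]} -> V) u :
    linear f -> linear g ->
  (forall b, b \in msupp u -> f << b >> = g << b >>) -> f u = g u.
Proof.
move=> lf lg efg.
have ->: u = \sum_(b <- msupp u) u@_b *: << b >>.
  rewrite {1}[u]monalgE; apply: eq_bigr => b _.
  by apply/malgP => c; rewrite mcoeffZ !mcoeffU mulrnAr mulr1.
rewrite (linear_comb _ _ _ lf) (linear_comb _ _ _ lg) big_seq [RHS]big_seq.
by apply: eq_bigr => b ub; rewrite efg.
Qed.

(** Linear extension of [F]; [comul] and [tensmap] are instances up to conversion and inherit
    linearity. *)
Definition lext V (F : K -> V) u : V := \sum_(b <- msupp u) u@_b *: F b.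

Lemma lext_fset V (F : K -> V) (d : {fset K}) u :
  (msupp u `<=` d)%fset -> lext F u = \sum_(b <- d) u@_b *: F b.
Proof.
move=> sud; apply: big_fset_incl => // b _ /mcoeff_outdom ->; exact: scale0r.
Qed.

Lemma lext_linear V (F : K -> V) : linear (lext F).
Proof.
move=> a u v; pose d := (msupp (a *: u + v) `|` (msupp u `|` msupp v))%fset.
have ud: (msupp u `<=` d)%fset by rewrite /d fsubsetU // fsubsetUl orbT.
have vd: (msupp v `<=` d)%fset by rewrite /d fsubsetU // fsubsetUr orbT.
rewrite (lext_fset F ud) (lext_fset F vd) (lext_fset F (fsubsetUl _ _) : _ = \sum_(b <- d) _).
rewrite scaler_sumr -big_split; apply: eq_bigr => b _ /=.
by rewrite mcoeffD mcoeffZ scalerDl scalerA.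
Qed.

Lemma lextU V (F : K -> V) b : lext F << b >> = F b.
Proof.
by rewrite /lext msuppU oner_eq0 big_seq_fset1 mcoeffUU scale1r.
Qed.

End LinearExtension.

(** * Tensors and comultiplication in coordinates *)

Section QuantumPlane.
Variables (k : fieldType) (q : k).
Implicit Types (u v h : Hv k) (f g : Hv k -> Hv k).

Lemma mcoeff_linear (K : choiceType) (b : K) :
  linear (fun h : {malg k[K]} => h@_b : k^o).
Proof. by move=> a u v; rewrite mcoeffD mcoeffZ. Qed.

Lemma comp_linear (U V W : lmodType k) (f : V -> W) (g : U -> V) :
  linear f -> linear g -> linear (f \o g).
Proof. by move=> lf lg a u v /=; rewrite lg lf. Qed.

(* A constant of its own, so that rewriting does not match coefficients in H (x) H
   against coefficients in H, a comparison that unfolds down to finite maps. *)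
Definition tcoeff (a c : KB) (w : Tv k) : k := w@_(a, c).

Lemma tcoeffDZ a c x w w' : tcoeff a c (x *: w + w') = x * tcoeff a c w + tcoeff a c w'.
Proof. exact: mcoeff_linear. Qed.

Lemma tcoeff_inj w w' : (forall a c, tcoeff a c w = tcoeff a c w') -> w = w'.
Proof. by move=> eww'; apply/malgP => -[a c]; apply: eww'. Qed.

Lemma tcoeffU (p : (KB * KB)%type) a c :
  tcoeff a c << p >> = ((p.1 == a) && (p.2 == c))%:R.
Proof. by case: p => b d; rewrite /tcoeff mcoeffU xpair_eqE. Qed.

Lemma tcoeff_tens a c u v : tcoeff a c (tens u v) = u@_a * v@_c.
Proof.
have single w b (F : k -> k) : F 0 = 0 ->
    \sum_(b' <- msupp w) F w@_b' *+ (b' == b) = F (w : Hv k)@_b.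
  move=> F0; case: (boolP (b \in msupp w)) => wb.
    rewrite (big_fsetD1 b) //= eqxx big_seq big1 ?addr0 // => b'.
    by rewrite !inE => /andP[/negbTE-> _].
  rewrite (mcoeff_outdom wb) F0 big_seq big1 // => b' wb'.
  by case: eqP wb => // <-; rewrite wb'.
rewrite /tcoeff /tens raddf_sum /= -(@single u a ( *%R^~ v@_c)) ?mul0r //.
apply: eq_bigr => a' _; rewrite raddf_sum /= -(@single v c ( *%R u@_a')) ?mulr0 //.
rewrite -sumrMnl; apply: eq_bigr => c' _.
by rewrite mcoeffU xpair_eqE -mulrnA mulnC mulnb.
Qed.

Lemma tens_linearl v : linear (fun u => tens u v).
Proof.
move=> x u u'; apply: tcoeff_inj => a c.
rewrite -> tcoeffDZ, !tcoeff_tens.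
by rewrite mcoeff_linear [LHS]mulrDl mulrA.
Qed.

Lemma tens_linearr u : linear (tens u).
Proof.
move=> x v v'; apply: tcoeff_inj => a c.
rewrite -> tcoeffDZ, !tcoeff_tens.
by rewrite mcoeff_linear [LHS]mulrDr mulrCA.
Qed.

Lemma tensUU (a c : KB) : tens (<< a >> : Hv k) << c >> = << (a, c) >>.
Proof.
apply: tcoeff_inj => b d.
by rewrite tcoeff_tens tcoeffU !mcoeffU -natrM mulnb.
Qed.

Lemma tensmap_linear f : linear (tensmap f).
Proof. exact: lext_linear. Qed.

Lemma tensmapU f (p : (KB * KB)%type) :
  tensmap f << p >> = tens (f << p.1 >>) (f << p.2 >>).
Proof. exact: (lextU (fun p => tens (f << p.1 >>) (f << p.2 >>))). Qed.

Lemma tensmap_tens f u v : linear f -> tensmap f (tens u v) = tens (f u) (f v).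
Proof.
move=> lf.
apply: (malg_basis_eq (f := fun u => tensmap f (tens u v))
                      (g := fun u => tens (f u) (f v))).
- exact: (comp_linear (@tensmap_linear f) (@tens_linearl v)).
- exact: (comp_linear (@tens_linearl (f v)) lf).
move=> a _.
apply: (malg_basis_eq (f := fun v => tensmap f (tens << a >> v))
                      (g := fun v => tens (f << a >>) (f v))).
- exact: (comp_linear (@tensmap_linear f) (@tens_linearr _)).
- exact: (comp_linear (@tens_linearr _) lf).
by move=> c _; rewrite tensUU tensmapU.
Qed.

Lemma tensmap_comp f g w :
  linear f -> linear g -> tensmap (f \o g) w = tensmap f (tensmap g w).
Proof.
move=> lf lg; apply: (malg_basis_eq (g := tensmap f \o tensmap g)).
- exact: tensmap_linear.
- exact: comp_linear (@tensmap_linear f) (@tensmap_linear g).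
by move=> p _; rewrite /= !tensmapU tensmap_tens.
Qed.

Lemma tensmap_id (w : Tv k) : tensmap id w = w.
Proof.
apply: (malg_basis_eq (g := id)) => //; first exact: tensmap_linear.
by move=> [a c] _; rewrite tensmapU tensUU.
Qed.

Lemma comul_linear : linear (comul q).
Proof. exact: lext_linear. Qed.

Lemma comulU (b : KB) : comul q << b >> = comul_basis q b.
Proof. exact: (lextU (comul_basis q)). Qed.

(** In the coproduct of x^n y^m only the summand with index [i] can have left factor x^a y^i; it
    then forces n = a, m = i + j and c = a + i. *)
Lemma tcoeff_comul h (a c : int) (i j : nat) :
  tcoeff (a, i) (c, j) (comul q h) =
    (qbinom q (i + j) i * h@_(a, (i + j)%N)) *+ (c == a + i%:Z).
Proof.
apply: (malg_basis_eq (V := k^o)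
   (f := tcoeff (a, i) (c, j) \o comul q)
   (g := fun h : Hv k => (qbinom q (i + j) i * h@_(a, (i + j)%N)) *+ (c == a + i%:Z))).
- exact: (comp_linear (f := tcoeff _ _ : Tv k -> k^o) (@tcoeffDZ _ _) comul_linear).
- move=> x u v; rewrite mcoeff_linear mulrDr mulrnDl mulrCA; congr (_ + _).
  by rewrite -[LHS]mulrnAr.
move=> [n m] _; rewrite /= comulU /comul_basis.
rewrite (linear_comb _ _ _ (V := k^o) (@tcoeffDZ _ _)).
under eq_bigr => l _ do rewrite tcoeffU !xpair_eqE /= -[_ *: _]/(qbinom q m l * _).
rewrite mcoeffU xpair_eqE.
have [->|nm] := eqVneq n a; last first.
  by rewrite big1 ?mulr0 ?mul0rn // => l _; rewrite mulr0.
have [E|nE] := eqVneq m (i + j)%N.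
  have im: (i < m.+1)%N by rewrite E ltnS leq_addr.
  rewrite (bigD1 (Ordinal im)) //= big1 ?addr0; last first.
    by move=> l /negbTE; rewrite -val_eqE /= => ->; rewrite mulr0.
  by rewrite E addKn !eqxx andbT /= [c == _]eq_sym mulr1; case: eqP; rewrite /= ?mulr1 ?mulr0.
rewrite mulr0 mul0rn big1 // => l _.
have [El|] := eqVneq (l : nat) i; last by rewrite /= mulr0.
case: (_ - _ =P j)%N => [Ej|]; last by rewrite !andbF mulr0.
by move: nE; rewrite -Ej -El subnKC ?eqxx // -ltnS.
Qed.

Lemma tensmap_comulU f (n : int) (m : nat) :
  tensmap f (comul q << (n, m) >>) =
    \sum_(i < m.+1) qbinom q m i *:
       tens (f << (n, (i : nat)) >>) (f << (n + (i : nat)%:Z, (m - i)%N) >>).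
Proof.
rewrite comulU /comul_basis (linear_comb _ _ _ (@tensmap_linear f)).
by apply: eq_bigr => i _; rewrite tensmapU.
Qed.

Lemma tcoeff_tensmap_comulU f (n : int) (m : nat) a c :
  tcoeff a c (tensmap f (comul q << (n, m) >>)) =
    \sum_(i < m.+1) qbinom q m i *
       ((f << (n, (i : nat)) >>)@_a * (f << (n + (i : nat)%:Z, (m - i)%N) >>)@_c).
Proof.
rewrite tensmap_comulU (linear_comb _ _ _ (V := k^o) (@tcoeffDZ _ _)).
by apply: eq_bigr => i _; rewrite tcoeff_tens.
Qed.

(** * The filtration by degree in y *)

Definition filt (m : nat) h := forall b, b \in msupp h -> (b.2 <= m)%N.

Lemma filtP m h : filt m h <-> forall b, (m < b.2)%N -> h@_b = 0.
Proof.
split=> [hm b mb|h0 b].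
  by apply: mcoeff_outdom; apply: contraL mb => /hm; rewrite -leqNgt.
by rewrite -mcoeff_neq0 leqNgt; apply: contraNN => /h0 ->.
Qed.

Lemma filtU m (b : KB) : (b.2 <= m)%N -> filt m (<< b >> : Hv k).
Proof. by move=> bm c; rewrite msuppU oner_eq0 inE => /eqP ->. Qed.

Lemma filtW m m' h : (m <= m')%N -> filt m h -> filt m' h.
Proof. by move=> mm' hm b /hm bm; apply: leq_trans mm'. Qed.

(** The bound is a successor because the quotients are indexed by positive integers. *)
Lemma filt_exhaustive h : exists m, filt m.+1 h.
Proof.
exists (\max_(b <- msupp h) b.2) => b hb; apply: leqW.
exact: (leq_bigmax_seq (F := fun b : KB => b.2) b).
Qed.

(** * Nonvanishing of q-binomials and preservation of the filtration *)

Section NotRootOfUnity.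
Hypothesis (hqroot : forall n : nat, (0 < n)%N -> q ^+ n != 1).

Lemma qint_neq0 n : qint q n.+1 != 0.
Proof.
apply: contraNneq (hqroot (ltn0Sn n)) => q0.
by rewrite -subr_eq0 subrX1 -/(qint q n.+1) q0 mulr0.
Qed.

Lemma qfact_neq0 n : qfact q n != 0.
Proof. by apply/prodf_neq0 => i _; apply: qint_neq0. Qed.

Lemma qbinom_neq0 m i : qbinom q m i != 0.
Proof. by rewrite !mulf_neq0 ?invr_neq0 ?mulf_neq0 ?qfact_neq0. Qed.

Lemma qbinom0 m : qbinom q m 0 = 1.
Proof. by rewrite /qbinom subn0 {2}/qfact big_ord0 mul1r divff ?qfact_neq0. Qed.

Lemma qbinomn m : qbinom q m m = 1.
Proof. by rewrite /qbinom subnn {3}/qfact big_ord0 mulr1 divff ?qfact_neq0. Qed.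

(* Comparing coefficients in Delta (f (x^n y)) suffices, so group-likes need not be
   classified. *)
Lemma Aut_star_grouplike f (n : int) : Aut_star q f -> f (mon k n 0) = mon k n 0.
Proof.
case=> -[[lf _ fcomul _] _] fy.
(* The coefficient of x^r y (x) x^r y in f(x^p) (x) f(x^p) is the square of the one sought; in a
   coproduct it vanishes, since r differs from r + 1. *)
have coef_y (p r : int) : (f << (p, 0%N) >>)@_(r, 1%N) = 0.
  have := congr1 (tcoeff (r, 1%N) (r, 1%N)) (fcomul << (p, 0%N) >>).
  rewrite tcoeff_comul tcoeff_tensmap_comulU big_ord1 qbinom0 mul1r addr0 subn0.
  have -> : (r == r + 1%:Z) = false by rewrite -[X in X == _]addr0 (inj_eq (addrI r)).
  rewrite mulr0n => /esym/eqP.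
  by rewrite mulf_eq0 orbb => /eqP.
(* After the shift the target is x^(n+1), which is the right factor of x^n y (x) x^(n+1) in the
   coproduct of x^n y. *)
rewrite -[n](subrK 1); move: (n - 1) => {}n; have [beta fyn] := fy n.
have coef_fy j : (f << (n, 1%N) >>)@_(n, (1 + j)%N) = (j == 0%N)%:R.
  rewrite [f _]fyn /mon mcoeffD mcoeffZ mcoeffB !mcoeffU !xpair_eqE !andbF.
  by rewrite subrr mulr0 addr0 eqxx eqSS eq_sym.
apply/malgP => -[c j].
(* By [coef_y] the summand x^n (x) x^n y contributes nothing; the other gives the coefficient of x^c
   y^j in f(x^(n+1)). *)
have := congr1 (tcoeff (n, 1%N) (c, j)) (fcomul << (n, 1%N) >>).
rewrite tcoeff_comul tcoeff_tensmap_comulU big_ord_recl big_ord1 /= -[bump 0 0]/1%N.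
rewrite coef_y mul0r mulr0 add0r qbinomn mul1r coef_fy (coef_fy 0%N) mul1r subnn => <-.
rewrite /mon mcoeffU xpair_eqE.
case: j => [|j] /=; last by rewrite mulr0 andbF mul0rn.
by rewrite qbinomn mul1r andbT eq_sym.
Qed.

Lemma Aut_star_filtU f (n : int) (m : nat) :
  Aut_star q f -> filt m (f << (n, m) >>).
Proof.
move=> fG; have [[[lf _ fcomul _] _] _] := fG.
elim/ltn_ind: m n => -[_ n|m IH n].
  by rewrite [f _](Aut_star_grouplike n fG); apply: filtU.
apply/filtP => -[a [//|M]] /=; rewrite ltnS => mM.
have /eqP := congr1 (tcoeff (a, M) (a + M%:Z, 1%N)) (fcomul << (n, m.+1) >>).
rewrite tcoeff_comul eqxx mulr1n addn1 tcoeff_tensmap_comulU big1 => [|i _].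
  by rewrite mulf_eq0 (negbTE (qbinom_neq0 _ _)) => /eqP.
(* For i = m + 1 the right factor is a power of x, without y; for i <= m the left factor has degree
   at most i < M by induction. *)
have := ltn_ord i; rewrite ltnS leq_eqVlt => /predU1P[->|im].
  by rewrite subnn [f << (_, 0%N) >>](Aut_star_grouplike _ fG) mcoeffU xpair_eqE andbF !mulr0.
have /filtP-> := IH _ im n; first by rewrite mul0r mulr0.
exact: leq_trans mM.
Qed.

Lemma Aut_star_filt f m h : Aut_star q f -> filt m h -> filt m (f h).
Proof.
move=> fG hm; have [[[lf _ _ _] _] _] := fG; apply/filtP => b mb.
apply: (malg_basis_eq (V := k^o) (f := (fun h : Hv k => h@_b : k^o) \o f)
  (g := fun _ => 0)).
- exact: (comp_linear (@mcoeff_linear _ b) lf).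
- by move=> x u v; rewrite scaler0 addr0.
move=> [n c] /hm /= cm; have /filtP := Aut_star_filtU fG : filt c (f << (n, c) >>); apply.
exact: leq_ltn_trans mb.
Qed.

End NotRootOfUnity.

(** * The automorphism groups and normality *)

Lemma Aut_c_comp f g : Aut_c q f -> Aut_c q g -> Aut_c q (f \o g).
Proof.
move=> [lf bf cf ef] [lg bg cg eg]; split.
- exact: (comp_linear lf lg).
- exact: bij_comp.
- by move=> h; rewrite (tensmap_comp _ lf lg) -cg /= cf.
- by move=> h; rewrite /= ef eg.
Qed.

Lemma Aut_c_id : Aut_c q id.
Proof.
split=> //; first by exists id.
by move=> h; rewrite tensmap_id.
Qed.

Lemma Aut_c_inv f g : Aut_c q f -> cancel f g -> cancel g f -> Aut_c q g.
Proof.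
move=> [lf _ cf ef] fg gf.
have lg : linear g by move=> a u v; apply: (can_inj fg); rewrite lf !gf.
have gof : g \o f = id by apply: functional_extensionality => x; apply: fg.
split=> [||h|h]; [exact: lg | by exists f | | by rewrite -ef gf].
(* Writing h as f(g(h)) lets [tensmap g] cancel the [tensmap f] produced by [f]. *)
by rewrite -[in RHS](gf h) cf -(tensmap_comp _ lg lf) gof tensmap_id.
Qed.

Lemma linear_shift f (u v w : Hv k) (a : k) :
  linear f -> f (w + a *: (u - v)) = f w + a *: (f u - f v).
Proof.
move=> lf; have lfB : f (u - v) = f u - f v.
  by rewrite addrC -scaleN1r lf scaleN1r addrC.
by rewrite addrC lf lfB addrC.
Qed.

Section AutGroups.
Hypothesis (hqroot : forall n : nat, (0 < n)%N -> q ^+ n != 1).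

(** Both powers of x are fixed by [f]. Hence the scalars beta_n add under composition and change
    sign under inversion. *)
Lemma Aut_star_shift f (n : int) w a : Aut_star q f ->
  f (w + a *: (mon k (n + 1) 0 - mon k n 0)) =
    f w + a *: (mon k (n + 1) 0 - mon k n 0).
Proof.
move=> fG; have [[[lf _ _ _] _] _] := fG; rewrite (linear_shift _ _ _ _ lf).
by rewrite -> !(fun p => Aut_star_grouplike hqroot p fG).
Qed.

Lemma Aut_star_group : is_group (Aut_star q).
Proof.
split=> [|f g|f g].
- split; first by split=> //; apply: Aut_c_id.
  by move=> n; exists 0; rewrite scale0r addr0.
- move=> fG gG; have [[fC f1] fy] := fG; have [[gC g1] gy] := gG.
  split=> [|n]; first by split; [apply: Aut_c_comp | rewrite /= g1 f1].
  have [bf fyn] := fy n; have [bg gyn] := gy n; exists (bf + bg).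
  have comb (V : lmodType k) (w z : V) : w + bf *: z + bg *: z = w + (bf + bg) *: z.
    by rewrite scalerDl addrA.
  apply: (etrans (congr1 f gyn)).
  rewrite -> (Aut_star_shift n _ _ fG), fyn.
  exact: comb.
- move=> fG fg gf; have [[fC f1] fy] := fG; split=> [|n].
    by split; [apply: Aut_c_inv gf | rewrite -{1}f1 fg].
  have [b fyn] := fy n; exists (- b); apply: (can_inj fg).
  have cancelb (V : lmodType k) (w z : V) : w = w + b *: z + - b *: z by rewrite scaleNr addrK.
  rewrite -> gf, (Aut_star_shift n _ _ fG), fyn.
  exact: cancelb.
Qed.

Lemma Aut_star_has_inverses : has_inverses (Aut_star q).
Proof.
move=> f fG; have [[[_ [g fg gf] _ _] _] _] := fG.
by exists g => //; have [_ _ inv] := Aut_star_group; apply: inv fG fg gf.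
Qed.

Lemma Aut_mS m m' f : (m <= m')%N -> Aut_m q m' f -> Aut_m q m f.
Proof. by move=> mm' [fC f1]; split=> // h hm; apply: f1; apply: filtW hm. Qed.

(** For m >= 1 the elements 1 and x^n y lie in the fixed part, so beta_n = 0. *)
Lemma Aut_m_star m f : (0 < m)%N -> Aut_m q m f -> Aut_star q f.
Proof.
move=> m0 [fC f1]; split=> [|n]; first by split=> //; apply/f1/filtU.
by exists 0; rewrite scale0r addr0; apply/f1/filtU.
Qed.

Lemma Aut_m_group m : is_group (Aut_m q m).
Proof.
split=> [|f g [fC f1] [gC g1]|f g [fC f1] fg gf].
- by split=> //; apply: Aut_c_id.
- by split=> [|h hm]; [apply: Aut_c_comp | rewrite /= g1 // f1].
- by split=> [|h hm]; [apply: Aut_c_inv gf | rewrite -{1}(f1 h hm) fg].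
Qed.

Lemma Aut_m_has_inverses m : has_inverses (Aut_m q m).
Proof.
move=> f fN; have [[_ [g fg gf] _ _] _] := fN.
by exists g => //; have [_ _ inv] := Aut_m_group m; apply: inv fN fg gf.
Qed.

Lemma Aut_m_normal m : (0 < m)%N -> is_normal_subgroup (Aut_star q) (Aut_m q m).
Proof.
move=> m0; split=> [|f|f g n fG fg gf nN]; first exact: Aut_m_group.
  exact: Aut_m_star.
have [_ Gmul inv] := Aut_star_group; have gG := inv _ _ fG fg gf.
have [[fC _] _] := fG; have [[gC _] _] := gG; have [nC n1] := nN.
split=> [|h hm]; first by apply: Aut_c_comp => //; apply: Aut_c_comp.
by rewrite /= n1 ?gf //; apply: (Aut_star_filt hqroot gG).
Qed.

(** * Gluing a compatible family of automorphisms *)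

Lemma Aut_star_glue (F : nat -> Hv k -> Hv k) :
    (forall i, (0 < i)%N -> Aut_star q (F i)) ->
    (forall i j h, (0 < i)%N -> (i <= j)%N -> filt i h -> F j h = F i h) ->
  exists2 f, Aut_star q f & forall i h, (0 < i)%N -> filt i h -> f h = F i h.
Proof.
move=> FG Fstable.
have Flin i : (0 < i)%N -> linear (F i) by case/FG => -[[]].
(* On x^n y^m the map [F m.+1] is used rather than [F m], keeping the index positive when m = 0. *)
pose f := lext (fun b : KB => F b.2.+1 (<< b >> : Hv k)).
have lf : linear f := lext_linear _.
have fE i h : (0 < i)%N -> filt i h -> f h = F i h.
  move=> i0 hi; apply: malg_basis_eq (lf) (Flin _ i0) _ => b /hi bi.
  rewrite /f lextU; have [ib|] := leqP i b.2.+1.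
    by apply: Fstable => //; apply: filtU.
  by move=> /ltnW bi'; apply/esym/Fstable => //; apply: filtU.
exists f => //.
(* All tensor factors in the coproduct of x^n y^m have degree at most m, so [f] may be replaced by
   [F m.+1] throughout. *)
have fmul : forall h, comul q (f h) = tensmap f (comul q h).
  move=> h; apply: (malg_basis_eq (f := comul q \o f) (g := tensmap f \o comul q)).
  - exact: comp_linear comul_linear lf.
  - exact: comp_linear (@tensmap_linear f) comul_linear.
  move=> [n m] _; rewrite /= (fE m.+1) //; last exact/filtU/leqnSn.
  have [[[_ _ -> _] _] _] := FG _ (ltn0Sn m); rewrite !tensmap_comulU.
  apply: eq_bigr => i _; rewrite !(fE m.+1) //; apply: filtU => /=.
    by apply: leqW; rewrite leq_subr.
  exact: ltnW.
have fcounit : forall h, counit (f h) = counit h.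
  by move=> h; have [m hm] := filt_exhaustive h; rewrite (fE m.+1) //; case: (FG m.+1) => // -[[]].
(* The preimage of [y] under [F m.+1] stays in the same filtration step, where [f] agrees with
   [F m.+1]. *)
have [g gf] : exists g, cancel g f.
  apply: (@functional_choice _ _ (fun y x => f x = y)) => y.
  have [m ym] := filt_exhaustive y.
  have [g gG [_ gK]] := Aut_star_has_inverses (FG _ (ltn0Sn m)).
  exists (g y); rewrite (fE m.+1) ?gK //; exact: (Aut_star_filt hqroot gG).
have finj : injective f.
  move=> u v; have [m um] := filt_exhaustive u; have [m' vm'] := filt_exhaustive v.
  pose M := (maxn m m').+1.
  have uM : filt M u by apply: filtW um; rewrite ltnS leq_maxl.
  have vM : filt M v by apply: filtW vm'; rewrite ltnS leq_maxr.
  rewrite (fE M u) // (fE M v) //.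
  by have [[[_ /bij_inj inj _ _] _] _] := FG M isT => /inj.
have fbij : bijective f by exists g => // x; apply: finj; rewrite gf.
split; first split; first by split.
  have [[_ F1] _] := FG 1%N isT; rewrite -[RHS]F1.
  by apply: fE => //; apply: filtU.
move=> n; have [_ /(_ n)[b Fb]] := FG 1%N isT.
by exists b; rewrite -Fb; apply: fE => //; apply: filtU.
Qed.

End AutGroups.
End QuantumPlane.

(** * The inverse system and its limit *)

Theorem theorem3p9 (k : fieldType) (q : k)
    (hq0 : q != 0) (hqroot : forall n : nat, (0 < n)%N -> q ^+ n != 1) :
  let G := @Aut_star k q in
  let N := fun i : nat => @Aut_m k q i in
  let pi := fun i : nat => qproj (N i) in
  let Phi := fun (f : Hv k -> Hv k) (i : nat) => lcoset (N i) f in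
  let in_lim := fun fam : nat -> mset (Hv k) =>
    (forall i, (0 < i)%N -> in_quot G (N i) (fam i)) /\
    (forall i j, (0 < i)%N -> (i <= j)%N -> pi i (fam j) = fam i) in
  [/\ (* Aut_*(H) is a group and each Aut_i(H) (i >= 1) is a normal subgroup *)
      is_group G,
      (forall i, (0 < i)%N -> is_normal_subgroup G (N i)),
      (* pi_i^j : Aut_*/Aut_j -> Aut_*/Aut_i is a well-defined epimorphism *)
      (forall i j, (0 < i)%N -> (i <= j)%N ->
         [/\ (forall C, in_quot G (N j) C -> in_quot G (N i) (pi i C)),
             (forall C D, in_quot G (N j) C -> in_quot G (N j) D ->
               pi i (setmul C D) = setmul (pi i C) (pi i D)) &
             (forall C', in_quot G (N i) C' ->
               exists2 C, in_quot G (N j) C & pi i C = C')]),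
      (* inverse system: pi_i^i = id and pi_i^j o pi_j^l = pi_i^l *)
      ((forall i C, (0 < i)%N -> in_quot G (N i) C -> pi i C = C) /\
      (forall i j l C, (0 < i)%N -> (i <= j)%N -> (j <= l)%N ->
         in_quot G (N l) C -> pi i (pi j C) = pi i C)) &
      (* phi |-> (phi Aut_i)_i is a group isomorphism onto the inverse limit *)
      [/\ (forall f, G f -> in_lim (Phi f)),
          (forall f g i, G f -> G g -> (0 < i)%N ->
            Phi (f \o g) i = setmul (Phi f i) (Phi g i)),
          (forall f g, G f -> G g ->
            (forall i, (0 < i)%N -> Phi f i = Phi g i) -> f = g) &
          (forall fam, in_lim fam ->
            exists2 f, G f & forall i, (0 < i)%N -> Phi f i = fam i)]].
Proof.
move=> G N pi Phi in_lim.
have Ggr : is_group G := Aut_star_group hqroot.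
have Ginv : has_inverses G := Aut_star_has_inverses hqroot.
have Nnormal i (i0 : (0 < i)%N) : is_normal_subgroup G (N i) := Aut_m_normal hqroot i0.
have Ngr i : is_group (N i) := Aut_m_group q i.
have Ninv i : has_inverses (N i) := @Aut_m_has_inverses k q i.
have piE i j f : (i <= j)%N -> pi i (lcoset (N j) f) = lcoset (N i) f.
  by move=> ij; apply: qproj_lcoset => // h; apply: Aut_mS.
have mulE i f g : (0 < i)%N -> G g ->
    setmul (lcoset (N i) f) (lcoset (N i) g) = lcoset (N i) (f \o g).
  by move=> i0; apply: setmul_lcoset Ginv (Nnormal i i0).
have quot i f : G f -> in_quot G (N i) (lcoset (N i) f) by exists f.
have GM f g : G f -> G g -> G (f \o g) by case: Ggr => _ + _; apply.
split=> //.
- move=> i j i0 ij; have j0 := leq_trans i0 ij; split.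
  + by move=> _ [f [fG ->]]; rewrite piE //; apply: quot.
  + by move=> _ _ [f [fG ->]] [g [gG ->]]; rewrite mulE // !piE // mulE.
  + move=> _ [f [fG ->]]; exists (lcoset (N j) f); first exact: quot.
    exact: piE.
- split=> [i _ i0 [f [_ ->]]|i j l _ i0 ij jl [f [_ ->]]]; first exact: piE.
  by rewrite !piE //; apply: leq_trans jl.
- split.
  + by move=> f fG; split=> [i i0|i j i0 ij]; [apply: quot | apply: piE].
  + by move=> f g i fG gG i0; rewrite /Phi mulE.
  + move=> f g fG gG efg; apply: functional_extensionality => h.
    have [m hm] := filt_exhaustive h.
    (* Equality of cosets at m + 1 gives g = f x with [x] fixing [h]. *)
    have : Phi g m.+1 g by apply: lcoset_id.
    by rewrite -efg // => -[x [[_ x1] ->]] /=; rewrite x1.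
move=> fam [famG famE].
(* Coset representatives are chosen; [id] fills the unconstrained index 0. *)
have [F FP] : exists F : nat -> Hv k -> Hv k,
    forall i, (0 < i)%N -> G (F i) /\ fam i = lcoset (N i) (F i).
  apply: (@functional_choice _ _
    (fun i f => (0 < i)%N -> G f /\ fam i = lcoset (N i) f)) => i.
  by case: (posnP i) => [->|/famG [f fP]]; [exists id | exists f].
have FG i : (0 < i)%N -> G (F i) by case/FP.
have Fstable i j h : (0 < i)%N -> (i <= j)%N -> filt i h -> F j h = F i h.
  move=> i0 ij hi; have j0 := leq_trans i0 ij.
  (* Compatibility turns the coset of [F j] modulo [N i] into that of [F i], so the two differ by a
     map fixing [h]. *)
  have : lcoset (N i) (F j) (F j) by apply: lcoset_id.
  rewrite -(piE i j) // -(proj2 (FP j j0)) famE // (proj2 (FP i i0)).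
  by case=> x [[_ x1] ->] /=; rewrite x1.
have [f fG fE] := Aut_star_glue hqroot FG Fstable.
exists f => // i i0; rewrite (proj2 (FP i i0)) /Phi.
have [g gG [Fg gF]] := Ginv _ (FG i i0).
(* The factor [g \o f] lies in [N i]: on degrees at most i, [f] equals [F i], which [g] inverts. *)
have -> : f = F i \o (g \o f) by apply: functional_extensionality => h /=; rewrite gF.
apply: lcoset_mulr => //; split; first by have [[]] := GM _ _ gG fG.
by move=> h hi /=; rewrite (fE i) // Fg.
Qed.
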